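(* Let $b>a>0$, $q>1$, $q\ge p>0$, let $m,\ell\in\mathbb{R}$ with $m>0$ and $m\ge2\ell\ge0$, and let $s\in\mathbb{R}$. (1) If either $s>1$ and $(s-1)q\ge1$, or $s<1$ and $s\ne0$, then $$\left|\frac{2\ell A(a^s,b^s)+(m-2\ell)[A(a,b)]^s}{m}-[L_s(a,b)]^s\right|\le\frac{b-a}{4m^2}|s|\left(\frac{q-1}{2q-p-1}\right)^{1-1/q}\left[\frac1{2m(p+1)(p+2)}\right]^{1/q}$$ $$\times\Big[(2\ell)^{(2q-p-1)/(q-1)}+(m-2\ell)^{(2q-p-1)/(q-1)}\Big]^{1-1/q}$$ $$\times\Big\{\Big[\big((2\ell)^{p+2}+(mp+m+2\ell)(m-2\ell)^{p+1}\big)a^{(s-1)q}+\big((2mp+4m-2\ell)(2\ell)^{p+1}+(mp+3m-2\ell)(m-2\ell)^{p+1}\big)b^{(s-1)q}\Big]^{1/q}$$ $$+\Big[\big((2mp+4m-2\ell)(2\ell)^{p+1}+(mp+3m-2\ell)(m-2\ell)^{p+1}\big)a^{(s-1)q}+\big((2\ell)^{p+2}+(mp+m+2\ell)(m-2\ell)^{p+1}\big)b^{(s-1)q}\Big]^{1/q}\Big\}.$$ (2) If $s=-1$, then $$\left|\frac1m\left[\frac{2\ell}{H(a,b)}+\frac{m-2\ell}{A(a,b)}\right]-\frac1{L(a,b)}\right|\le\frac{b-a}{4m^2}\left(\frac{q-1}{2q-p-1}\right)^{1-1/q}\left[\frac1{2m(p+1)(p+2)}\right]^{1/q}$$ $$\times\Big[(2\ell)^{(2q-p-1)/(q-1)}+(m-2\ell)^{(2q-p-1)/(q-1)}\Big]^{1-1/q}$$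 $$\times\left\{\left[\frac{(2\ell)^{p+2}+(mp+m+2\ell)(m-2\ell)^{p+1}}{a^{2q}}+\frac{(2mp+4m-2\ell)(2\ell)^{p+1}+(mp+3m-2\ell)(m-2\ell)^{p+1}}{b^{2q}}\right]^{1/q}\right.$$ $$\left.+\left[\frac{(2mp+4m-2\ell)(2\ell)^{p+1}+(mp+3m-2\ell)(m-2\ell)^{p+1}}{a^{2q}}+\frac{(2\ell)^{p+2}+(mp+m+2\ell)(m-2\ell)^{p+1}}{b^{2q}}\right]^{1/q}\right\}.$$
   Context: For positive numbers $a,b$: $A(a,b)=\frac{a+b}2$; $H(a,b)=\frac{2ab}{a+b}$; $L(a,b)=\frac{b-a}{\ln b-\ln a}$ if $a\ne b$ and $L(a,a)=a$; $I(a,b)=\frac1e\left(\frac{b^b}{a^a}\right)^{1/(b-a)}$ if $a\ne b$ and $I(a,a)=a$; and the generalized logarithmic mean is, for $a\neq b$, $L_s(a,b)=\left[\frac{b^{s+1}-a^{s+1}}{(s+1)(b-a)}\right]^{1/s}$ if $s\ne0,-1$, $L_{-1}(a,b)=L(a,b)$, $L_0(a,b)=I(a,b)$, while $L_s(a,a)=a$. *)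

(* Defs.v *)
From HB Require Import structures.
From mathcomp Require Import all_boot all_order all_algebra.
From mathcomp Require Import reals sequences exp.

Set Implicit Arguments.
Unset Strict Implicit.
Unset Printing Implicit Defensive.

Import Order.TTheory GRing.Theory Num.Theory.
Local Open Scope ring_scope.

(* The means are meant for positive arguments.  On a positive base [x `^ y]
   is [expR (y * ln x)]. *)

Definition arith_mean (R : realType) (a b : R) : R := (a + b) / 2.

Definition harm_mean (R : realType) (a b : R) : R := 2 * a * b / (a + b).

Definition log_mean (R : realType) (a b : R) : R :=
  if a == b then a else (b - a) / (ln b - ln a).

Definition identric_mean (R : realType) (a b : R) : R :=
  if a == b then a
  else (expR 1)^-1 * (b `^ b / a `^ a) `^ (1 / (b - a)).

Definition gen_log_mean (R : realType) (s a b : R) : R :=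
  if a == b then a
  else if s == 0 then identric_mean a b
  else if s == -1 then log_mean a b
  else ((b `^ (s + 1) - a `^ (s + 1)) / ((s + 1) * (b - a))) `^ (1 / s).

(* Main.v *)
Require Import Defs.
From mathcomp Require Import all_boot all_order all_algebra.
From mathcomp Require Import reals sequences exp.
From mathcomp Require Import ring lra interval_inference.
From mathcomp Require Import unstable classical_sets topology normedtype.
From mathcomp Require Import derive realfun convex hoelder.

(** Write [P := 2 l], [Q := m - 2 l] (so [m = P + Q]) and [c := (a + b) / 2].
The power [L_s(a,b)^s] is the mean of [x^s] over [[a, b]], so the left-hand
side is the error of a quadrature rule mixing, with weights [P] and [Q], the
trapezoidal and the midpoint rules.  The error splits at [c].  On the left half
put [x = a + k w], [k = (b - a) / (2 m)], [0 <= w <= m]; integration by parts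
with the kernel [w - P] gives, for [f x = x^s],

  [P f(a) + Q f(c) - int_0^m f(a + k w) dw = int_0^m (w - P) k f'(a + k w) dw].

The right half is the same statement with [b] and [-k] instead of [a] and [k].
The remaining integral is estimated by writing
[|w - P| = |w - P|^((q-p)/q) |w - P|^(p/q)] and using Hoelder's inequality with
exponents [q/(q-1)] and [q]; then [|f'|^q = |s|^q x^((s-1)q)] is convex
([powR_convex]: in both cases of the hypothesis on [s] the exponent [(s-1)q] is
nonpositive or at least [1]), so it lies below its chord on [[a, b]].  What is left are moments of [|w - P|], and they are the explicit
constants of the theorem.

No integral occurs in the formal proof.  Hoelder's inequality follows from
Young's inequality normalized by the two integrals [A] and [B]
([young_scaled]); this is a pointwise bound of a derivative by a combination of
powers whose primitive is explicit, and [increment_le] turns it into a bound on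
increments.  [holder_side] does this on one side of the zero of the kernel,
[kernel_increment] glues the two sides, [half_bound] specializes to powers,
[power_mean_bound] adds the two halves.  The part for [s = -1] is the first part
rewritten: [A(1/a, 1/b) = 1 / H(a,b)] and [L_{-1} = L]. *)

Import Order.TTheory GRing.Theory Num.Theory.
Import numFieldNormedType.Exports.
Local Open Scope ring_scope.
Local Open Scope classical_set_scope.
Set Implicit Arguments.
Unset Strict Implicit.

(** * Convexity and Young's inequality for real powers *)

(** For [e <= 0], [x^e = exp (e ln x)] with [e ln x] convex, and [exp] is
convex and increasing. *)
Lemma powR_convex (R : realType) (e x y w : R) :
  e <= 0 \/ 1 <= e -> 0 < x -> 0 < y -> 0 <= w <= 1 ->
  (w * x + (1 - w) * y) `^ e <= w * x `^ e + (1 - w) * y `^ e.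
Proof.
move=> he x0 y0 /andP[w0 w1]; pose t := Itv01 w0 w1.
have [e0|e1] := he; last first.
  have := @convex_powR R e e1 t x y; rewrite !convRE/=.
  by apply; rewrite inE/= in_itv/= andbT ltW.
have w1' : 0 <= 1 - w by rewrite subr_ge0.
have z0 : 0 < w * x + (1 - w) * y.
  by have := convR_gt0 t x0 y0; rewrite convRE.
have := @concave_ln R t x y x0 y0; rewrite !convRE/= /onem => hln.
have := @convex_expR R t (e * ln x) (e * ln y); rewrite !convRE/= /onem.
rewrite /powR !gt_eqF//; apply: le_trans.
rewrite ler_expR [X in _ <= X](_ : _ = e * (w * ln x + (1 - w) * ln y)).
  by rewrite ler_wnM2l.
by ring.
Qed.

(** Dividing [u] and [v] by [A] and [B] before applying Young's inequality makes
it lossless after integration: if [A] and [B] are the integrals of [u] and [v],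
the right-hand side integrates to [A^(1-1/q) B^(1/q)], which is Hoelder's
bound. *)
Lemma young_scaled (R : realType) (q A B u v : R) :
  1 < q -> 0 < A -> 0 < B -> 0 <= u -> 0 <= v ->
  u `^ (1 - 1 / q) * v `^ (1 / q) <=
  A `^ (1 - 1 / q) * B `^ (1 / q) * ((1 - 1 / q) * (u / A) + 1 / q * (v / B)).
Proof.
move=> q1 A0 B0 u0 v0; have q0 : 0 < q by exact: lt_trans q1.
set t := 1 / q.
have t0 : 0 < t by rewrite divr_gt0.
have t1 : 0 < 1 - t by rewrite subr_gt0 /t ltr_pdivrMr// mul1r.
have uA : 0 <= u / A by rewrite divr_ge0// ltW.
have vB : 0 <= v / B by rewrite divr_ge0// ltW.
have := @conjugate_powR R ((u / A) `^ (1 - t)) ((v / B) `^ t) (1 - t)^-1 t^-1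
  (powR_ge0 _ _) (powR_ge0 _ _).
rewrite !invr_gt0 !invrK subrK => /(_ t1 t0 erefl).
rewrite -!powRrM !mulfV ?gt_eqF// !powRr1// => H.
have -> : u `^ (1 - t) * v `^ t =
    A `^ (1 - t) * B `^ t * ((u / A) `^ (1 - t) * (v / B) `^ t).
  rewrite mulrACA -!powRM// ?(ltW A0) ?(ltW B0)//.
  by rewrite !(mulrC _ (_ / _)) !divfK ?gt_eqF.
rewrite ler_wpM2l ?mulr_ge0 ?powR_ge0//.
by rewrite (mulrC (1 - t)) (mulrC t).
Qed.

(** * Comparing increments through derivatives *)

(** The substitute for [|int F'| <= int |F'| <= int G']: the mean value theorem
applied to [G - F] and to [G + F]. *)
Lemma increment_le (R : realType) (F dF G dG : R -> R) (u v : R) : u <= v ->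
  (forall x : R, x \in `]u, v[%R -> is_derive x 1 F (dF x)) ->
  (forall x : R, x \in `]u, v[%R -> is_derive x 1 G (dG x)) ->
  {within `[u, v], continuous F} -> {within `[u, v], continuous G} ->
  (forall x : R, x \in `]u, v[%R -> `|dF x| <= dG x) ->
  `|F v - F u| <= G v - G u.
Proof.
rewrite le_eqVlt => /predU1P[->|uv] HF HG cF cG H.
  by rewrite !subrr normr0.
have [x xI] := @MVT R (fun x => G x - F x) (fun x => dG x - dF x) u v uv
  (fun x xI => is_deriveB (HG x xI) (HF x xI))
  (fun x => cvgB (cG x) (cF x)).
have [y yI] := @MVT R (fun x => G x + F x) (fun x => dG x + dF x) u v uv
  (fun x xI => is_deriveD (HG x xI) (HF x xI))
  (fun x => cvgD (cG x) (cF x)).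
have /ler_normlP[+ +] := H _ xI; have /ler_normlP[+ +] := H _ yI.
move=> h1 h2 h3 h4 e1 e2.
by apply/ler_normlP; split; nra.
Qed.

(** The powers below have primitives [y^r] whose derivative may fail to exist at
the zero of the kernel, hence only continuity up to [0] is used there. *)
Lemma within_continuous_powR (R : realType) (z r : R) : 0 <= z -> 0 < r ->
  {within `[0, z], continuous (@powR R ^~ r)}.
Proof.
rewrite le_eqVlt => /predU1P[<-|z0] r0.
  by rewrite set_itv1; exact: continuous_subspace1.
have C x : 0 < x -> {for x, continuous (@powR R ^~ r)}.
  move=> x0; apply/differentiable_continuous/derivable1_diffP.
  by have [] := @is_derive1_powR R r x x0.
apply/continuous_within_itvP => //; split.
- by move=> x; rewrite in_itv/= => /andP[x0 _]; exact: C.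
- by rewrite powR0 ?gt_eqF//; exact: powR_cvg0.
- by apply: cvg_at_left_filter; exact: C.
Qed.

Lemma within_continuous_is_derive (R : realType) (F dF : R -> R) (u v : R) :
  (forall x : R, x \in `[u, v]%R -> is_derive x 1 F (dF x)) ->
  {within `[u, v], continuous F}.
Proof.
move=> H; apply: derivable_within_continuous => x xI.
by have [] := H x xI.
Qed.

(** * Hoelder's inequality against the kernel *)

(** Hoelder's inequality on one side of the zero of the kernel, [y] being the
distance to that zero.  Here [r - 1 = (q-p)/(q-1)], so that
[y = (y^(r-1))^(1-1/q) (y^p)^(1/q)]; Young's inequality is applied to
[u = y^(r-1)] and [v = y^p g(y)].  The normalizations [A] and [B] are free
because they must be the integrals over both sides of the zero together. *)
Lemma holder_side (R : realType) (p q r c l0 l1 A B z : R) (F dF g : R -> R) :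
  1 < q -> 0 < p -> p <= q -> r = (2 * q - p - 1) / (q - 1) ->
  0 <= c -> 0 < A -> 0 < B -> 0 <= z ->
  (forall y : R, y \in `[0, z]%R -> is_derive y 1 F (dF y)) ->
  (forall y : R, y \in `]0, z[%R -> 0 <= g y <= l0 + l1 * y) ->
  (forall y : R, y \in `]0, z[%R -> `|dF y| <= c * (y * g y `^ (1 / q))) ->
  `|F z - F 0| <= c * (A `^ (1 - 1 / q) * B `^ (1 / q)) *
    ((1 - 1 / q) * (z `^ r / r / A) +
     1 / q * ((l0 * (z `^ (p + 1) / (p + 1)) +
               l1 * (z `^ (p + 2) / (p + 2))) / B)).
Proof.
move=> q1 p0 pq hr c0 A0 B0 z0 HF Hg HdF.
have r0 : 0 < r by rewrite hr divr_gt0//; lra.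
set t := 1 / q; set K := A `^ (1 - t) * B `^ t.
pose k0 := c * K * (1 - t) / r / A.
pose k1 := c * K * t * l0 / (p + 1) / B.
pose k2 := c * K * t * l1 / (p + 2) / B.
pose G y := k0 * y `^ r + k1 * y `^ (p + 1) + k2 * y `^ (p + 2).
pose dG y := c * K * ((1 - t) * (y `^ (r - 1) / A) +
     t * ((l0 * y `^ p + l1 * y `^ (p + 1)) / B)).
have G0 : G 0 = 0 by rewrite /G !powR0 ?gt_eqF//; [ring|lra|lra].
suff : `|F z - F 0| <= G z - G 0.
  move=> /le_trans; apply; rewrite G0 le_eqVlt; apply/orP; left; apply/eqP.
  by rewrite /G /k0 /k1 /k2; ring.
have dF' (y : R) : y \in `]0, z[%R -> is_derive y 1 F (dF y).
  by move=> yI; apply: HF; apply: (subset_itv_oo_cc yI).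
have dG' (y : R) : y \in `]0, z[%R -> is_derive y 1 G (dG y).
  move=> /[!in_itv]/= /andP[y0 _].
  have D k s : is_derive y 1 (fun y => k * y `^ s : R) (k * (s * y `^ (s - 1))).
    exact: is_deriveZ (is_derive1_powR s y0).
  apply: is_derive_eq (is_deriveD (is_deriveD (D k0 r) (D k1 _)) (D k2 _)) _.
  have e1 : p + 1 - 1 = p by ring.
  have e2 : p + 2 - 1 = p + 1 by ring.
  rewrite e1 e2 /dG /k0 /k1 /k2.
  generalize (y `^ (r - 1)) (y `^ (p + 1)) (y `^ p) K; clearbody t.
  move=> a1 a2 a3 k; field.
  by apply/and5P; split; rewrite gt_eqF//; clear -p0; lra.
have cG : {within `[0, z], continuous G}.
  have C k s : 0 < s -> {within `[0, z], continuous (fun y => k * y `^ s : R)}.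
    move=> s0 x; apply: cvgMr; exact: within_continuous_powR.
  move=> x; apply: cvgD; first apply: cvgD; apply: C; lra.
apply: (increment_le z0 dF' dG' (within_continuous_is_derive HF) cG).
move=> y yI; apply: le_trans (HdF y yI) _.
have /andP[g0 gl] := Hg y yI.
move: yI; rewrite in_itv/= => /andP[y0 _].
rewrite /dG -mulrA ler_wpM2l//.
have -> : y * g y `^ t = (y `^ (r - 1)) `^ (1 - t) * (y `^ p * g y) `^ t.
  rewrite powRM ?powR_ge0// -!powRrM mulrA -powRD; last first.
    by apply/implyP => _; rewrite gt_eqF.
  rewrite (_ : (r - 1) * (1 - t) + p * t = 1) ?powRr1 ?(ltW y0)//.
  rewrite hr /t; field; apply/andP; split; rewrite gt_eqF; clear -q1; lra.
apply: le_trans (young_scaled q1 A0 B0 _ _) _; rewrite ?mulr_ge0 ?powR_ge0//.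
rewrite -/t -/K; apply: ler_wpM2l; first by rewrite mulr_ge0 ?powR_ge0.
rewrite lerD2l; apply: ler_wpM2l; first by rewrite divr_ge0//; lra.
apply: ler_wpM2r; first by rewrite invr_ge0 ltW.
have -> : y `^ (p + 1) = y `^ p * y.
  by rewrite powRD ?powRr1 ?(ltW y0)//; apply/implyP => _; rewrite gt_eqF.
rewrite (_ : _ + _ = y `^ p * (l0 + l1 * y)); last by ring.
by rewrite ler_wpM2l ?powR_ge0.
Qed.

(** [(p+1)(p+2)] times the integral of [|w - P|^p (2 m - w)] over
[0 <= w <= m = P + Q]: the weight of the endpoint of [[a, b]] that belongs to
the half under consideration. *)
Definition near_weight (R : realType) (m P Q p : R) : R :=
  (2 * m * p + 4 * m - P) * P `^ (p + 1) + (m * p + 3 * m - P) * Q `^ (p + 1).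

(** [(p+1)(p+2)] times the integral of [|w - P|^p w] over [0 <= w <= m = P + Q]:
the weight of the opposite endpoint of [[a, b]]. *)
Definition far_weight (R : realType) (m P Q p : R) : R :=
  P `^ (p + 2) + (m * p + m + P) * Q `^ (p + 1).

Lemma near_weight_gt0 (R : realType) (m P Q p : R) :
  0 < p -> 0 <= P -> 0 <= Q -> m = P + Q -> 0 < m -> 0 < near_weight m P Q p.
Proof.
move=> p0 P0 Q0 hm m0; have mp : 0 < m * p by rewrite mulr_gt0.
have : 0 < P \/ 0 < Q.
  by move: P0; rewrite le_eqVlt => /predU1P[P0|]; [right; lra|left].
case=> h.
  by rewrite ltr_pwDl ?mulr_gt0 ?mulr_ge0 ?powR_gt0 ?powR_ge0//; lra.
by rewrite ltr_wpDl ?mulr_gt0 ?mulr_ge0 ?powR_gt0 ?powR_ge0//; lra.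
Qed.

Lemma far_weight_ge0 (R : realType) (m P Q p : R) :
  0 < p -> 0 <= P -> 0 <= m -> 0 <= far_weight m P Q p.
Proof.
move=> p0 P0 m0; have mp : 0 <= m * p by rewrite mulr_ge0// ltW.
by rewrite addr_ge0 ?mulr_ge0 ?powR_ge0//; lra.
Qed.

Lemma is_derive_shift (R : realType) (F : R -> R) (d k y dF : R) :
  is_derive (d + k * y) 1 F dF ->
  is_derive y 1 (fun y => F (d + k * y)) (k * dF).
Proof.
move=> HF.
have D : is_derive y 1 (fun y => d + k * y : R) k.
  apply: is_derive_eq
    (is_deriveD (is_derive_cst d y 1) (is_deriveZ k (is_derive_id y 1))) _.
  by rewrite add0r; exact: mulr1.
rewrite mulrC.
exact: (@is_derive1_comp _ F (fun y => d + k * y) y dF k HF D).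
Qed.

(** The estimate on one half of the interval.  [F w = (w - P) phi w - Psi w] has
derivative [(w - P) phi' w], and [F m - F 0] is the quadrature error.  The two
sides of [P] are treated by [holder_side] in the variables [w = P + y] and
[w = P - y]; the bound on [g] is affine, so both sides contribute explicit powers,
and the first-order terms enter with opposite signs. *)
Lemma kernel_increment (R : realType) (m P Q p q r c g0 g1 : R)
    (Psi phi dphi g : R -> R) :
  1 < q -> 0 < p -> p <= q -> r = (2 * q - p - 1) / (q - 1) ->
  0 <= P -> 0 <= Q -> m = P + Q -> 0 < m -> 0 <= c -> 0 < g0 -> 0 < g1 ->
  (forall w : R, w \in `[0, m]%R -> is_derive w 1 Psi (phi w)) ->
  (forall w : R, w \in `[0, m]%R -> is_derive w 1 phi (dphi w)) ->
  (forall w : R, w \in `[0, m]%R ->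
     0 <= g w <= ((2 * m - w) * g0 + w * g1) / (2 * m)) ->
  (forall w : R, w \in `[0, m]%R -> `|dphi w| <= c * g w `^ (1 / q)) ->
  `|P * phi 0 + Q * phi m - (Psi m - Psi 0)| <=
  c * (((P `^ r + Q `^ r) / r) `^ (1 - 1 / q) *
       ((near_weight m P Q p * g0 + far_weight m P Q p * g1) /
        (2 * m * (p + 1) * (p + 2))) `^ (1 / q)).
Proof.
move=> q1 p0 pq hr P0 Q0 hm m0 c0 g00 g10 HPsi Hphi Hg Hdphi.
have r0 : 0 < r by rewrite hr divr_gt0//; lra.
have powS x : 0 <= x -> x `^ (p + 2) = x * x `^ (p + 1).
  move=> x0; rewrite (_ : p + 2 = 1 + (p + 1)); last by ring.
  by rewrite (@powRD _ x 1) ?powRr1//; apply/implyP; rewrite gt_eqF//; lra.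
set A := _ / r; set N := _ * g0 + _; set B := N / _.
have A0 : 0 < A.
  rewrite divr_gt0//.
  move: P0; rewrite le_eqVlt => /predU1P[P0|P0].
    by rewrite ltr_wpDl ?powR_ge0 ?powR_gt0//; lra.
  by rewrite ltr_pwDl ?powR_ge0 ?powR_gt0.
have Pm : P <= m by lra.
have N0 : 0 < N.
  by rewrite ltr_pwDl ?mulr_gt0 ?mulr_ge0 ?near_weight_gt0
       ?far_weight_ge0// ltW.
have B0 : 0 < B by rewrite divr_gt0// !mulr_gt0//; lra.
pose F w := (w - P) * phi w - Psi w.
have HF (w : R) : w \in `[0, m]%R -> is_derive w 1 F ((w - P) * dphi w).
  move=> wI.
  have Did : is_derive w 1 (fun w => w - P : R) 1.
    by apply: is_derive_eq
      (is_deriveB (is_derive_id w 1) (is_derive_cst P w 1)) (subr0 _).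
  apply: is_derive_eq (is_deriveB (is_deriveM Did (Hphi w wI)) (HPsi w wI)) _.
  have -> : (w - P) *: dphi w + phi w *: 1 - phi w =
             (w - P) * dphi w + phi w * 1 - phi w by [].
  by rewrite mulr1 addrK.
pose l0 := ((2 * m - P) * g0 + P * g1) / (2 * m).
pose l1 := (g1 - g0) / (2 * m).
have side (k z : R) : k ^+ 2 = 1 -> 0 <= z ->
    (forall y : R, y \in `[0, z]%R -> P + k * y \in `[0, m]%R) ->
  `|F (P + k * z) - F P| <= c * (A `^ (1 - 1 / q) * B `^ (1 / q)) *
    ((1 - 1 / q) * (z `^ r / r / A) +
     1 / q * ((l0 * (z `^ (p + 1) / (p + 1)) +
               (k * l1) * (z `^ (p + 2) / (p + 2))) / B)).
  move=> k1 z0 hk.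
  have dFk (y : R) : y \in `[0, z]%R ->
      is_derive y 1 (fun y => F (P + k * y)) (k * (k * y * dphi (P + k * y))).
    move=> yI; apply: is_derive_shift.
    by have := HF _ (hk y yI); rewrite (addrC P) addrK.
  have gk (y : R) : y \in `]0, z[%R -> 0 <= g (P + k * y) <= l0 + k * l1 * y.
    move=> yI; have := Hg _ (hk y (subset_itv_oo_cc yI)).
    rewrite (_ : _ / (2 * m) = l0 + k * l1 * y)// /l0 /l1.
    by field; rewrite gt_eqF.
  have dFg (y : R) : y \in `]0, z[%R ->
      `|k * (k * y * dphi (P + k * y))| <= c * (y * g (P + k * y) `^ (1 / q)).
    move=> yI; have := Hdphi _ (hk y (subset_itv_oo_cc yI)).
    move: yI; rewrite in_itv/= => /andP[y0 _] h.
    rewrite !mulrA -expr2 k1 mul1r normrM gtr0_norm//.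
    by rewrite (mulrC c) -mulrA ler_wpM2l// ltW.
  by have := holder_side q1 p0 pq hr c0 A0 B0 z0 dFk gk dFg;
     rewrite mulr0 addr0.
(* [k = 1] is the side [w >= P], [k = -1] the side [w <= P]. *)
have IR (y : R) : y \in `[0, Q]%R -> P + 1 * y \in `[0, m]%R.
  by rewrite !in_itv/= => /andP[? ?]; lra.
have IL (y : R) : y \in `[0, P]%R -> P + -1 * y \in `[0, m]%R.
  by rewrite !in_itv/= => /andP[? ?]; lra.
have hR := side 1 Q (expr1n _ 2) Q0 IR.
have k1 : (-1) ^+ 2 = 1 :> R by rewrite sqrrN expr1n.
have hL := side (-1) P k1 P0 IL.
rewrite (_ : _ - _ = (F (P + 1 * Q) - F P) - (F (P + -1 * P) - F P)); last first.
  by rewrite /F mul1r -hm mulN1r subrr hm; ring.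
apply: le_trans (ler_normB _ _) _; apply: le_trans (lerD hR hL) _.
rewrite -mulrDr -[leRHS]mulr1 le_eqVlt; apply/orP; left; apply/eqP.
congr (_ * _).
have EA : P `^ r / r + Q `^ r / r = A by rewrite -mulrDl.
set X := _ + 1 * l1 * _; set Y := _ + -1 * l1 * _.
have EB : X + Y = B.
  rewrite /X /Y /B /N /near_weight /far_weight /l0 /l1 !powS//.
  move: (P `^ (p + 1)) (Q `^ (p + 1)) => x y.
  rewrite hm; field; clear -p0 m0 hm.
  apply/and3P; split; rewrite gt_eqF//; lra.
(* The choice of [A] and [B] makes the Young weights add up to [1]. *)
rewrite [LHS](_ : _ = (1 - 1 / q) * ((P `^ r / r + Q `^ r / r) / A) +
                      1 / q * ((X + Y) / B)).
  by rewrite EA EB !mulfV ?gt_eqF// !mulr1 subrK.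
by clearbody X Y A B; ring.
Qed.

(** * Powers and their means *)

(** [L] is a primitive of [x^s].  The quotient under the outer power is a value
of [x^s] by the mean value theorem, hence nonnegative, which is what lets the
exponents [1/s] and [s] cancel. *)
Lemma gen_log_mean_powR (R : realType) (s a b : R) : 0 < a -> a < b -> s != 0 ->
  exists2 L : R -> R, (forall x : R, 0 < x -> is_derive x 1 L (x `^ s)) &
    gen_log_mean s a b `^ s = (L b - L a) / (b - a).
Proof.
move=> a0 ab s0; have b0 := lt_trans a0 ab.
rewrite /gen_log_mean lt_eqF// (negbTE s0); have [->|s1] := eqVneq s (-1).
  exists (@ln R) => [x x0|].
    by rewrite powR_inv1 ?ltW//; exact: is_derive1_ln.
  have lnab : ln a < ln b by rewrite ltr_ln ?posrE.
  rewrite /log_mean lt_eqF// powR_inv1 ?invf_div//.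
  by rewrite divr_ge0// subr_ge0 ltW.
have s10 : s + 1 != 0 by rewrite addr_eq0.
pose L x := (s + 1)^-1 * x `^ (s + 1).
have HL (x : R) : 0 < x -> is_derive x 1 L (x `^ s).
  move=> x0; apply: is_derive_eq
    (is_deriveZ (s + 1)^-1 (is_derive1_powR (s + 1) x0)) _.
  have -> : s + 1 - 1 = s by ring.
  exact: mulKf.
exists L => //.
have Lab : (b `^ (s + 1) - a `^ (s + 1)) / ((s + 1) * (b - a)) =
    (L b - L a) / (b - a).
  by rewrite /L -mulrBr invfM mulrA (mulrC _ (s + 1)^-1).
rewrite Lab -powRrM div1r mulVf// powRr1//.
have I x : x \in `[a, b]%R -> 0 < x.
  by rewrite in_itv/= => /andP[ax _]; exact: lt_le_trans ax.
have C : {within `[a, b], continuous L}.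
  by apply: within_continuous_is_derive => x /I; exact: HL.
have D (x : R) : x \in `]a, b[%R -> is_derive x 1 L (x `^ s).
  by move=> xI; apply: HL; exact: I (subset_itv_oo_cc xI).
have [x _ ->] := MVT ab D C.
by rewrite mulfK ?powR_ge0// gt_eqF// subr_gt0.
Qed.

(** Here [e0] and [e1] are the two endpoints and [k] may have either sign, which
covers both halves at once: [e0 + k w] runs from [e0] to the midpoint. *)
Lemma half_bound (R : realType) (s m P Q p q r e0 e1 k : R) (L : R -> R) :
  1 < q -> 0 < p -> p <= q -> r = (2 * q - p - 1) / (q - 1) ->
  0 <= P -> 0 <= Q -> m = P + Q -> 0 < m ->
  (s - 1) * q <= 0 \/ 1 <= (s - 1) * q ->
  0 < e0 -> 0 < e1 -> k != 0 -> e1 = e0 + k * (2 * m) ->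
  (forall x : R, 0 < x -> is_derive x 1 L (x `^ s)) ->
  `|P * e0 `^ s + Q * (e0 + k * m) `^ s - (L (e0 + k * m) - L e0) / k| <=
  `|k| * `|s| * (((P `^ r + Q `^ r) / r) `^ (1 - 1 / q) *
       ((near_weight m P Q p * e0 `^ ((s - 1) * q) +
         far_weight m P Q p * e1 `^ ((s - 1) * q)) /
        (2 * m * (p + 1) * (p + 2))) `^ (1 / q)).
Proof.
move=> q1 p0 pq hr P0 Q0 hm m0 hs e00 e10 k0 he1 HL.
(* For [w <= m] the point stays in the half next to [e0], with weight
   [1 - w / (2 m)] on [e0] in the chord from [e0] to [e1]. *)
have xE w : e0 + k * w = (1 - w / (2 * m)) * e0 + (1 - (1 - w / (2 * m))) * e1.
  by rewrite he1; field; rewrite gt_eqF.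
have w01 w : w \in `[0, m]%R -> 0 <= 1 - w / (2 * m) <= 1.
  rewrite in_itv/= => /andP[w0 wm].
  by rewrite subr_ge0 ler_pdivrMr ?mulr_gt0// gerBl divr_ge0//;
    clear -w0 wm m0; lra.
have x0 w : w \in `[0, m]%R -> 0 < e0 + k * w.
  move=> /w01/andP[t0 t1]; rewrite xE.
  move: t0; rewrite le_eqVlt => /predU1P[<-|t0].
    by rewrite subr0 mul1r mul0r add0r.
  by rewrite ltr_pwDl ?mulr_gt0// mulr_ge0 ?subr_ge0// ltW.
have := @kernel_increment R m P Q p q r (`|k| * `|s|) (e0 `^ ((s - 1) * q))
  (e1 `^ ((s - 1) * q)) (fun w => k^-1 * L (e0 + k * w))
  (fun w => (e0 + k * w) `^ s) (fun w => k * (s * (e0 + k * w) `^ (s - 1)))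
  (fun w => (e0 + k * w) `^ ((s - 1) * q)) q1 p0 pq hr P0 Q0 hm m0.
rewrite mulr0 addr0 -mulrBr (mulrC k^-1); apply.
- by rewrite mulr_ge0.
- exact: powR_gt0.
- exact: powR_gt0.
- move=> w /x0 xw; apply: is_derive_eq
    (is_deriveZ k^-1 (is_derive_shift (HL _ xw))) _.
  exact: mulKf.
- by move=> w /x0 xw; exact: (is_derive_shift (is_derive1_powR s xw)).
- move=> w wI; rewrite powR_ge0/= [X in X `^ _]xE.
  apply: le_trans (powR_convex hs e00 e10 (w01 w wI)) _.
  rewrite le_eqVlt; apply/orP; left; apply/eqP.
  by field; rewrite gt_eqF.
- move=> w wI; rewrite -powRrM div1r mulfK ?gt_eqF//; last by lra.
  by rewrite !normrM mulrA (ger0_norm (powR_ge0 _ _)).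
Qed.

(** The two halves, with [k] and [-k], have the same constants and exchanged
roles of [a] and [b], whence the sum of two [1/q]-th powers. *)
Lemma power_mean_bound (R : realType) (a b m P Q p q r s : R) :
  0 < a -> a < b -> 1 < q -> 0 < p -> p <= q ->
  r = (2 * q - p - 1) / (q - 1) -> 0 <= P -> 0 <= Q -> m = P + Q -> 0 < m ->
  (1 < s /\ 1 <= (s - 1) * q) \/ (s < 1 /\ s <> 0) ->
  `| (P * arith_mean (a `^ s) (b `^ s) + Q * (arith_mean a b) `^ s) / m
     - (gen_log_mean s a b) `^ s | <=
  (b - a) / (4 * m ^+ 2) * `|s| * ((q - 1) / (2 * q - p - 1)) `^ (1 - 1 / q)
     * (1 / (2 * m * (p + 1) * (p + 2))) `^ (1 / q)
     * (P `^ r + Q `^ r) `^ (1 - 1 / q)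
     * ((far_weight m P Q p * a `^ ((s - 1) * q) +
         near_weight m P Q p * b `^ ((s - 1) * q)) `^ (1 / q)
        + (near_weight m P Q p * a `^ ((s - 1) * q) +
           far_weight m P Q p * b `^ ((s - 1) * q)) `^ (1 / q)).
Proof.
move=> a0 ab q1 p0 pq hr P0 Q0 hm m0 hs.
have b0 := lt_trans a0 ab.
have r0 : 0 < r by rewrite hr divr_gt0//; clear -q1 pq; lra.
have s0 : s != 0 by apply/eqP; case: hs => -[]; lra.
have hs' : (s - 1) * q <= 0 \/ 1 <= (s - 1) * q.
  case: hs => -[s1 h]; [by right|left].
  by rewrite mulr_le0_ge0 ?subr_le0 ?(ltW s1)//; lra.
have m2 : 0 < 2 * m by rewrite mulr_gt0.
have [k k0 k2m] : exists2 k : R, 0 < k & k * (2 * m) = b - a.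
  by exists ((b - a) / (2 * m)); rewrite ?divfK ?divr_gt0 ?subr_gt0 ?gt_eqF.
have kc : a + k * m = arith_mean a b by rewrite /arith_mean; lra.
have kc' : b + - k * m = arith_mean a b by rewrite /arith_mean; lra.
have [L HL ->] := gen_log_mean_powR a0 ab s0.
have ea : b = a + k * (2 * m) by rewrite k2m; ring.
have eb : a = b + - k * (2 * m) by rewrite mulNr k2m; ring.
have kN : - k != 0 by rewrite oppr_eq0 gt_eqF.
have Ha := half_bound q1 p0 pq hr P0 Q0 hm m0 hs' a0 b0 (lt0r_neq0 k0) ea HL.
have Hb := half_bound q1 p0 pq hr P0 Q0 hm m0 hs' b0 a0 kN eb HL.
have W0 : 0 <= near_weight m P Q p by rewrite ltW// near_weight_gt0.
have V0 : 0 <= far_weight m P Q p by rewrite far_weight_ge0// ltW.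
move: W0 V0 Ha Hb; rewrite normrN (gtr0_norm k0) kc kc'.
move: (near_weight _ _ _ _) (far_weight _ _ _ _) => W V W0 V0 Ha Hb.
have splitE (N : R) : 0 <= N ->
    ((P `^ r + Q `^ r) / r) `^ (1 - 1 / q) *
    (N / (2 * m * (p + 1) * (p + 2))) `^ (1 / q) =
    ((q - 1) / (2 * q - p - 1)) `^ (1 - 1 / q)
     * (1 / (2 * m * (p + 1) * (p + 2))) `^ (1 / q)
     * (P `^ r + Q `^ r) `^ (1 - 1 / q) * N `^ (1 / q).
  move=> N0; have -> : (q - 1) / (2 * q - p - 1) = r^-1 by rewrite hr invf_div.
  set U := 2 * m * _ * _.
  have U0 : 0 <= U by rewrite !mulr_ge0//; clear -p0 m0; lra.
  rewrite (div1r U) (@powRM _ (_ + _) r^-1) ?(@powRM _ N U^-1) //;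
    rewrite ?addr_ge0 ?powR_ge0 ?invr_ge0 ?(ltW r0)//.
  by move: (N `^ _) (U^-1 `^ _) (r^-1 `^ _) (_ `^ _) => x1 x2 x3 x4; ring.
have NA : 0 <= W * a `^ ((s - 1) * q) + V * b `^ ((s - 1) * q).
  by rewrite addr_ge0 ?mulr_ge0 ?powR_ge0.
have NB : 0 <= W * b `^ ((s - 1) * q) + V * a `^ ((s - 1) * q).
  by rewrite addr_ge0 ?mulr_ge0 ?powR_ge0.
rewrite (splitE _ NA) in Ha; rewrite (splitE _ NB) in Hb.
rewrite (addrC (V * _)).
move: (_ `^ (1 - 1 / q)) (_ `^ (1 - 1 / q))
  (_ `^ (1 / q)) (_ `^ (1 / q)) (_ `^ (1 / q)) Ha Hb.
move=> d1 d2 x1 x2 x3.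
set SA := _ - _ / k; set SB := _ - _ / - k => Ha Hb.
have -> : (P * arith_mean (a `^ s) (b `^ s) + Q * arith_mean a b `^ s) / m
    - (L b - L a) / (b - a) = (SA + SB) / (2 * m).
  rewrite /SA /SB -k2m {1}/arith_mean; field.
  by apply/andP; split; rewrite gt_eqF.
clearbody SA SB; rewrite normrM normfV (gtr0_norm m2) ler_pdivrMr//.
apply: le_trans (ler_normD _ _) _; apply: le_trans (lerD Ha Hb) _.
rewrite le_eqVlt; apply/orP; left; apply/eqP.
rewrite -k2m; field.
by rewrite gt_eqF.
Qed.

(** * The bound for the means *)

Unset Implicit Arguments.
Set Strict Implicit.

Theorem theorem4p1 (R : realType) (a b p q m l s : R)
  (ha : 0 < a) (hab : a < b) (hq : 1 < q) (hp : 0 < p) (hpq : p <= q)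
  (hm : 0 < m) (hl : 0 <= 2 * l) (hml : 2 * l <= m) :
  ((1 < s /\ 1 <= (s - 1) * q) \/ (s < 1 /\ s <> 0) ->
    `| (2 * l * arith_mean (a `^ s) (b `^ s)
          + (m - 2 * l) * (arith_mean a b) `^ s) / m
       - (gen_log_mean s a b) `^ s |
    <= (b - a) / (4 * m ^+ 2) * `|s|
       * ((q - 1) / (2 * q - p - 1)) `^ (1 - 1 / q)
       * (1 / (2 * m * (p + 1) * (p + 2))) `^ (1 / q)
       * ((2 * l) `^ ((2 * q - p - 1) / (q - 1))
          + (m - 2 * l) `^ ((2 * q - p - 1) / (q - 1))) `^ (1 - 1 / q)
       * ((((2 * l) `^ (p + 2)
            + (m * p + m + 2 * l) * (m - 2 * l) `^ (p + 1))
             * a `^ ((s - 1) * q)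
           + ((2 * m * p + 4 * m - 2 * l) * (2 * l) `^ (p + 1)
              + (m * p + 3 * m - 2 * l) * (m - 2 * l) `^ (p + 1))
             * b `^ ((s - 1) * q)) `^ (1 / q)
          + (((2 * m * p + 4 * m - 2 * l) * (2 * l) `^ (p + 1)
              + (m * p + 3 * m - 2 * l) * (m - 2 * l) `^ (p + 1))
               * a `^ ((s - 1) * q)
             + ((2 * l) `^ (p + 2)
                + (m * p + m + 2 * l) * (m - 2 * l) `^ (p + 1))
               * b `^ ((s - 1) * q)) `^ (1 / q)))
  /\
  (s = -1 ->
    `| 1 / m * (2 * l / harm_mean a b + (m - 2 * l) / arith_mean a b)
       - 1 / log_mean a b |
    <= (b - a) / (4 * m ^+ 2)
       * ((q - 1) / (2 * q - p - 1)) `^ (1 - 1 / q)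
       * (1 / (2 * m * (p + 1) * (p + 2))) `^ (1 / q)
       * ((2 * l) `^ ((2 * q - p - 1) / (q - 1))
          + (m - 2 * l) `^ ((2 * q - p - 1) / (q - 1))) `^ (1 - 1 / q)
       * ((((2 * l) `^ (p + 2)
            + (m * p + m + 2 * l) * (m - 2 * l) `^ (p + 1))
             / a `^ (2 * q)
           + ((2 * m * p + 4 * m - 2 * l) * (2 * l) `^ (p + 1)
              + (m * p + 3 * m - 2 * l) * (m - 2 * l) `^ (p + 1))
             / b `^ (2 * q)) `^ (1 / q)
          + (((2 * m * p + 4 * m - 2 * l) * (2 * l) `^ (p + 1)
              + (m * p + 3 * m - 2 * l) * (m - 2 * l) `^ (p + 1))
               / a `^ (2 * q)
             + ((2 * l) `^ (p + 2)
                + (m * p + m + 2 * l) * (m - 2 * l) `^ (p + 1))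
               / b `^ (2 * q)) `^ (1 / q))).
Proof.
have main (t : R) := @power_mean_bound R a b m (2 * l) (m - 2 * l) p q
  ((2 * q - p - 1) / (q - 1)) t ha hab hq hp hpq erefl hl.
have Q0 : 0 <= m - 2 * l by rewrite subr_ge0.
have hm' : m = 2 * l + (m - 2 * l) by rewrite addrC subrK.
split; first exact: (main s Q0 hm' hm).
move=> _; have b0 := lt_trans ha hab.
have s1 : -1 < 1 :> R /\ -1 <> 0 :> R.
  by split; [lra | move/eqP; rewrite oppr_eq0 oner_eq0].
have := main (-1) Q0 hm' hm (or_intror s1); rewrite normrN1 mulr1.
have -> : (-1 - 1) * q = - (2 * q) by ring.
rewrite /near_weight /far_weight !(powRN _ (2 * q)); apply: le_trans.
rewrite le_eqVlt; apply/orP; left; apply/eqP; congr (`| _ - _|).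
- rewrite /arith_mean !powR_inv1 ?ltW//; last by rewrite divr_gt0 ?addr_gt0.
  rewrite /harm_mean; field.
  by rewrite !gt_eqF ?addr_gt0.
- rewrite /gen_log_mean /log_mean lt_eqF// eqxx oppr_eq0 oner_eq0 div1r.
  rewrite powR_inv1//.
  by rewrite divr_ge0// subr_ge0 ltW// ltr_ln ?posrE.
Qed.
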